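(* Let $\mu$ be an atomic (finite Borel) measure on $\mathbb R^d$ with finitely many atoms, and let $\alpha\in\mathbb R$. For any $x\notin\operatorname{int}(D_\alpha(\mu))$ and $F\in\mathfrak F(x,D_\alpha(\mu))$ there exists $H(x,F)\in\mathcal H(D_\alpha(\mu),F)$ such that $x\in H(x,F)$ and $\mu(\operatorname{int}(H(x,F)))<\alpha$. Moreover, each face $F$ of the convex polytope $D_\alpha(\mu)$ of dimension $\dim(F)<d$ is contained in the convex hull of at least $\min\{\dim(D_\alpha(\mu))+1,d\}$ atoms of $\mu$ located in a hyperplane in $\mathbb R^d$.
   Context: An atomic measure with finitely many atoms is a finite sum of positively weighted Dirac measures on $\mathbb R^d$. $\mathcal H$ is the set of closed halfspaces $H_{x,u}=\{y\in\mathbb R^d:\langle x,u\rangle\le\langle y,u\rangle\}$, $x\in\mathbb R^d$, $u\in\mathbb S^{d-1}$ (the unit sphere); $\mathcal H(x)=\{H_{x,u}:u\in\mathbb S^{d-1}\}$. $\operatorname{int},\operatorname{cl},\operatorname{bd},\operatorname{relint},\operatorname{conv}$ denote interior, closure, boundary, relative interior, convex hull; $\dim A$ is the dimension of the affine hull of $A$. Halfspace depth: $D(x;\mu)=\inf_{H\in\mathcal H(x)}\mu(H)$; $D_\alpha(\mu)=\{x:D(x;\mu)\ge\alpha\}$ (closed and convex). Touching halfspaces: for a non-empty convex set $A$, $\mathcal H(A)=\{H\in\mathcal H:H\cap\operatorname{cl}(A)\neq\emptyset,\ \operatorname{int}(H)\cap A=\emptyset\}$; $\mathcal H(\emptyset)=\mathcal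 H$. A face of a convex set $A$ is a convex subset $F\subseteq A$ such that $x,y\in A$ and $(x+y)/2\in F$ imply $x,y\in F$ (the empty set is a face); $\mathcal F(A)$ is the set of all faces of $\operatorname{cl}(A)$. For $F\in\mathcal F(A)$, $\mathcal H(A,F)=\{H\in\mathcal H(A):F\subseteq\operatorname{bd}(H)\}$. For $A$ convex and $x\notin\operatorname{int}(A)$: $\mathfrak F(x,A)=\{F\in\mathcal F(A):\operatorname{relint}(\operatorname{conv}(F\cup\{x\}))\cap\operatorname{cl}(A)=\emptyset\}$ if $x\notin\operatorname{cl}(A)$, and $\mathfrak F(x,A)=\{F\in\mathcal F(A):x\in\operatorname{relint}(F)\}$ if $x\in\operatorname{bd}(A)$; in particular $\mathfrak F(x,\emptyset)=\{\emptyset\}$.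
   Formalization: For α ≤ 0 the region is all of R^d, not a polytope, and its empty face would need d atoms (false for one Dirac mass in the plane); so polytopality is stated for α > 0, and the face claim for non-empty faces or α > 0. Dimension d ≥ 1 is assumed. *)

(* Defs.v *)
From HB Require Import structures.
From mathcomp Require Import all_boot all_order all_algebra finmap.
From mathcomp Require Import all_classical all_reals all_analysis.

Set Implicit Arguments.
Unset Strict Implicit.
Unset Printing Implicit Defensive.

Import Order.TTheory GRing.Theory Num.Theory.
Import numFieldNormedType.Exports.

Local Open Scope classical_set_scope.
Local Open Scope ring_scope.

(** ['rV[R]_d] equipped with its Borel sigma-algebra. *)
Definition borel_rV (R : realType) (d : nat) :=
  g_sigma_algebraType (@open 'rV[R]_d).

Section Definitions.
Context {R : realType} {d : nat}.
Local Notation E := 'rV[R]_d.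
Implicit Types (x u y : E) (A F H : set E).

Definition dotp x y : R := \sum_(i < d) x ord0 i * y ord0 i.

(** Euclidean unit sphere; the norm [`|u|] of the library on row vectors is the
    sup norm, so it is not used here. *)
Definition sphere : set E := [set u | Num.sqrt (dotp u u) = 1].

Definition halfspace x u : set E := [set y | dotp x u <= dotp y u].

Definition halfspaces : set (set E) :=
  [set H | exists x u, sphere u /\ H = halfspace x u].

Definition halfspaces_at x : set (set E) := [set halfspace x u | u in sphere].

Definition hyperplane (P : set E) : Prop :=
  exists u c, u != 0 /\ P = [set y | dotp y u = c].

Definition bd A : set E := closure A `\` A°.

Definition conv_hull A : set E := smallest (@convex_set R E) A.

Definition affine_set A : Prop :=
  forall x y (t : R), A x -> A y -> A (t *: x + (1 - t) *: y).

Definition aff_hull A : set E := smallest affine_set A.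

Definition relint A : set E :=
  [set x | aff_hull A x /\ \forall y \near x, aff_hull A y -> A y].

Definition direction A : set E :=
  [set v | exists y z, [/\ aff_hull A y, aff_hull A z & v = y - z]].

(** Dimension of the affine hull of [A]: the largest number of linearly
    independent vectors in the direction space of [aff_hull A]. The empty set
    has dimension -1. *)
Definition affdim A : int :=
  if `[< A !=set0 >] then
    Posz (\max_(k < d.+1 | `[< exists M : 'M[R]_(k, d),
      row_free M /\ forall i, direction A (row i M) >]) k)
  else -1.

Definition polytope A : Prop := exists2 V, finite_set V & A = conv_hull V.

Definition is_face A F : Prop :=
  [/\ @convex_set R E F, F `<=` A &
      forall x y, A x -> A y -> F (2^-1 *: (x + y)) -> F x /\ F y].

Definition faces A : set (set E) := [set F | is_face (closure A) F].

(** Every halfspace touches the empty set. *)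
Definition touching A : set (set E) :=
  [set H | halfspaces H /\
    (A !=set0 -> H `&` closure A !=set0 /\ H° `&` A = set0)].

Definition touching_face A F : set (set E) :=
  [set H | touching A H /\ F `<=` bd H].

(** Meant for [x] outside the interior of [A], so that exactly one of the two
    premises holds. *)
Definition visible_faces x A : set (set E) :=
  [set F | faces A F /\
    (~ closure A x ->
       relint (conv_hull (F `|` [set x])) `&` closure A = set0) /\
    (bd A x -> relint F x)].

Implicit Type mu : {measure set (borel_rV R d) -> \bar R}.

Definition finitely_atomic mu : Prop :=
  exists (n : nat) (a : 'I_n -> borel_rV R d) (w : 'I_n -> R),
    (forall i, 0 < w i) /\
    (forall A : set (borel_rV R d), measurable A ->
       mu A = (\sum_(i < n) (w i)%:E * \d_(a i) A)%E).

Definition atoms mu : set E := [set a | (0 < mu [set a])%E].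

Definition depth mu x : \bar R := ereal_inf [set mu H | H in halfspaces_at x].

Definition central_region mu (alpha : R) : set E :=
  [set x | (alpha%:E <= depth mu x)%E].

End Definitions.

(* Main.v *)
Require Import Defs.
From HB Require Import structures.
From mathcomp Require Import all_boot all_order all_algebra finmap.
From mathcomp Require Import all_classical all_reals all_analysis.
From mathcomp Require Import ring lra zify.

(** Let the measure have atoms [a i] of weight [w i]; the weight of a halfspace
is the sum of the [w i] over the atoms it contains, and [D] is the central
region. Call a pair [(x, u)] light if the open halfspace of points [y] with
[dotp x u < dotp y u] has weight below [alpha]. A point is outside [D] exactly
if some closed halfspace with that point on its boundary has weight below
[alpha]; hence a light open halfspace never meets [D] ([light_region]), and if
[z] is in [D] and [(z, u)] is light, the corresponding closed halfspace touches
[D] at [z].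

The halfspace of the first claim comes from limits. Strict inequalities between
finitely many atoms and a hyperplane persist under small motions, so lightness
is a closed condition on [(x, u)], and by compactness of the sphere it passes
to limits of [x] ([closed_light]). Applied to points outside [D] that converge
to a boundary point [x], this gives a light pair [(x, u)]
([light_of_boundary]). Applied to points that converge to [z] in [D] along the
segment from some [y], which meets [D] only in [z], it moreover gives [u] with
[dotp z u <= dotp y u] ([light_of_direction]). For [x] outside [D] and a
visible face [F], take [z] in the relative interior of [F] and [y] in the
relative interior of the convex hull of [F] and [x]: the half-open segment
stays in that relative interior, hence outside [D]. A linear functional that is
maximal over a convex set at a relative interior point is constant on the set
([relint_argmax]); this puts [F] into the bounding hyperplane and [x] into the
halfspace ([touching_face_exists]).

For polytopality, note that [D] is the intersection of the convex hulls of
those sets of atoms whose complement has weight below [alpha]. This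
intersection is a linear image of a bounded polyhedron given by nonnegativity
constraints and linear equations in the coefficients of all these convex
combinations simultaneously, and such a polyhedron is generated by its finitely
many basic points ([polytope_image]).

As to the atoms around a face, if [(z, u)] is light and [z] is in [D], every
point of [D] in the bounding hyperplane is a convex combination of the atoms in
that hyperplane: otherwise the hyperplane could be tilted around the point so
as to lose all these atoms, and the point would have depth below [alpha]
([hull_of_light]). So only the number of atoms in the hyperplane matters. While
the differences to [z] of the atoms in the hyperplane have rank below the
minimum of [d - 1] and the rank for all atoms, the hyperplane can be rotated
around their span until it hits a new atom; no atom changes side before that,
so the pair stays light, and the rank grows ([rotate]). As [z] itself is an
affine combination of the atoms in the hyperplane, their number exceeds the
rank ([card_touching]), and the rank for all atoms is at least the dimension of
[D] ([affdim_region]). *)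

Set Implicit Arguments.
Unset Strict Implicit.
Unset Printing Implicit Defensive.

Import Order.TTheory GRing.Theory Num.Theory.
Import numFieldNormedType.Exports.

Local Open Scope classical_set_scope.
Local Open Scope ring_scope.

(** * The Euclidean inner product *)

Section InnerProduct.
Context {R : realType} {d : nat}.
Local Notation E := 'rV[R]_d.
Implicit Types (x y z u v : E) (c t : R).

Lemma dotpC x y : dotp x y = dotp y x.
Proof. by apply: eq_bigr => i _; rewrite mulrC. Qed.

Lemma dotpDl x y u : dotp (x + y) u = dotp x u + dotp y u.
Proof. by rewrite -big_split; apply: eq_bigr => i _; rewrite mxE mulrDl. Qed.

Lemma dotpZl c x u : dotp (c *: x) u = c * dotp x u.
Proof. by rewrite mulr_sumr; apply: eq_bigr => i _; rewrite mxE mulrA. Qed.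

Lemma dotpDr u x y : dotp u (x + y) = dotp u x + dotp u y.
Proof. by rewrite !(dotpC u) dotpDl. Qed.

Lemma dotpZr c u x : dotp u (c *: x) = c * dotp u x.
Proof. by rewrite !(dotpC u) dotpZl. Qed.

Lemma dotpNl x u : dotp (- x) u = - dotp x u.
Proof. by rewrite -scaleN1r dotpZl mulN1r. Qed.

Lemma dotpBl x y u : dotp (x - y) u = dotp x u - dotp y u.
Proof. by rewrite dotpDl dotpNl. Qed.

Lemma dotpNr u x : dotp u (- x) = - dotp u x.
Proof. by rewrite !(dotpC u) dotpNl. Qed.

Lemma dotp0l u : dotp 0 u = 0.
Proof. by rewrite -(scale0r 0) dotpZl mul0r. Qed.

Lemma dotp_suml (I : finType) (F : I -> E) u :
  dotp (\sum_i F i) u = \sum_i dotp (F i) u.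
Proof.
by apply: (big_morph (fun x => dotp x u)) => [x y|]; rewrite (dotpDl, dotp0l).
Qed.

Lemma dotp_eq0 u : (dotp u u == 0) = (u == 0).
Proof.
rewrite psumr_eq0 => [|i _]; last by rewrite -expr2 sqr_ge0.
apply/allP/eqP => [u0|->]; last by move=> i _; rewrite mxE mulr0 eqxx.
apply/rowP => i; rewrite mxE; apply/eqP.
by have := u0 i (mem_index_enum i); rewrite implyTb mulf_eq0 orbb.
Qed.

Lemma exists_neq0 : (0 < d)%N -> exists u, u != 0.
Proof.
move=> d0; exists (delta_mx ord0 (Ordinal d0)).
apply/eqP => /matrixP/(_ ord0 (Ordinal d0)); rewrite !mxE !eqxx => /eqP.
by rewrite oner_eq0.
Qed.

Lemma dotp_ge0 u : 0 <= dotp u u.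
Proof. by apply: sumr_ge0 => i _; rewrite -expr2 sqr_ge0. Qed.

Lemma dotp_gt0 u : u != 0 -> 0 < dotp u u.
Proof. by move=> u0; rewrite lt_def dotp_eq0 u0 dotp_ge0. Qed.

Lemma cvg_dotp (T : Type) (F : set_system T) {FF : Filter F} (f g : T -> E)
    x y : f @ F --> x -> g @ F --> y -> dotp (f t) (g t) @[t --> F] --> dotp x y.
Proof.
move=> fx gy; apply: cvg_big => [|i _]; first exact: add_continuous.
by apply: cvgM; [exact: (cvg_comp _ _ fx (@coord_continuous _ _ _ _ _ x))
  |exact: (cvg_comp _ _ gy (@coord_continuous _ _ _ _ _ y))].
Qed.

Lemma dotpl_continuous u : continuous (fun x => dotp x u).
Proof. move=> x; exact: (@cvg_dotp _ (nbhs x) _ id (cst u) _ _ cvg_id (cvg_cst _)).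
Qed.

Lemma sphereP u : sphere u <-> dotp u u = 1.
Proof.
rewrite /sphere /=; split=> [/(congr1 (fun t => t ^+ 2))|->].
  by rewrite sqr_sqrtr ?dotp_ge0// expr1n.
exact: sqrtr1.
Qed.

Lemma sphere_neq0 u : sphere u -> u != 0.
Proof.
by move/sphereP=> u1; apply/eqP => u0; move: u1; rewrite u0 dotp0l => /eqP;
  rewrite eq_sym oner_eq0.
Qed.

Lemma compact_sphere : compact (@sphere R d).
Proof.
apply: bounded_closed_compact.
  exists 1; split=> // M M1 u /sphereP u1.
  rewrite /= [leLHS]/Num.norm /= mx_normrE.
  apply/bigmax_leP; split=> [|[i j] _ /=]; first by rewrite ltW// (lt_trans _ M1).
  rewrite ord1; apply: (le_trans _ (ltW M1)).
  rewrite -(@expr_le1 _ 2)// real_normK ?num_real// expr2 -u1.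
  rewrite /dotp (bigD1 j)//= lerDl sumr_ge0// => k _.
  by rewrite -expr2 sqr_ge0.
have -> : @sphere R d = (fun u => dotp u u) @^-1` [set 1].
  by apply/seteqP; split=> u /sphereP.
apply: closed_comp; last exact: closed_eq.
by move=> u _; exact: (@cvg_dotp _ (nbhs u) _ id id _ _ cvg_id cvg_id).
Qed.

Lemma open_halfspace_gt u c : open [set y | c < dotp y u].
Proof.
apply: (@open_comp _ _ (fun y => dotp y u) [set t | c < t]).
  by move=> ? _; exact: dotpl_continuous.
exact: open_gt.
Qed.

Lemma closed_halfspace x u : closed (halfspace x u).
Proof.
apply: (@closed_comp _ _ (fun y => dotp y u) [set t | dotp x u <= t]).
  by move=> ? _; exact: dotpl_continuous.
exact: closed_ge.
Qed.

(** Neighbourhoods are defined by the sup norm on coordinates; most arguments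
below only need the trace of a neighbourhood on a line. *)
Lemma nbhs_line x v (A : set E) : nbhs x A ->
  exists2 e, 0 < e & forall t, `|t| <= e -> A (x + t *: v).
Proof.
move=> xA; have : \forall t \near (0 : R), A (x + t *: v).
  have c : x + t *: v @[t --> 0] --> x + 0 *: v.
    apply: cvgD; first exact: cvg_cst.
    by apply: cvgZr_tmp; exact: cvg_id.
  by apply: c; rewrite scale0r addr0.
move=> /nbhs_ballP[e /= e0 eA]; exists (e / 2); first by rewrite divr_gt0.
move=> t te; apply: eA; rewrite /ball /= sub0r normrN (le_lt_trans te)//.
by rewrite ltr_pdivrMr// ltr_pMr// ltr1n.
Qed.

Lemma interior_halfspace x u : u != 0 ->
  (halfspace x u)° = [set y | dotp x u < dotp y u].
Proof.
move=> u0; apply/seteqP; split=> [y|]; last first.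
  rewrite -open_subsetE; first by move=> y /ltW.
  exact: open_halfspace_gt.
move=> /(nbhs_line (- u))[e e0 /(_ e)]; rewrite gtr0_norm// => /(_ (lexx _)).
rewrite /halfspace /= dotpDl dotpZl dotpNl => /le_lt_trans; apply.
by rewrite gtrDl mulrN oppr_lt0 mulr_gt0 ?dotp_gt0.
Qed.

Lemma bd_halfspace x u : u != 0 ->
  bd (halfspace x u) = [set y | dotp y u = dotp x u].
Proof.
move=> u0; rewrite /bd interior_halfspace//.
rewrite -(closure_id _).1; last exact: closed_halfspace.
apply/seteqP; split=> y /=; rewrite /halfspace /setD /=.
  by case=> xy /negP; rewrite -leNgt => yx; apply/le_anti; rewrite yx.
by move=> ->; split=> //; rewrite ltxx.
Qed.

End InnerProduct.

(** * Convex combinations and theorems of the alternative *)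

Section Convexity.
Context {R : realType} {d : nat}.
Local Notation E := 'rV[R]_d.
Implicit Types (x y z u v : E) (A C F : set E) (t : R).

Lemma convex_setP A : @convex_set R E A <->
  forall x y t, 0 <= t -> t <= 1 -> A x -> A y -> A (t *: x + (1 - t) *: y).
Proof.
split=> [cA x y t t0 t1 Ax Ay|cA x y t /set_mem Ax /set_mem Ay].
  by have := cA x y (Itv01 t0 t1) (mem_set Ax) (mem_set Ay); rewrite inE.
by apply/mem_set; exact: cA.
Qed.

(** Points are absorbed one at a time: [w *: x] stands for the weighted sum of
the points absorbed so far, whose average [x] is in [C]. *)
Lemma convex_sum C (I : finType) (l : I -> R) (p : I -> E) :
  @convex_set R E C -> (forall i, 0 <= l i) -> \sum_i l i = 1 ->
  (forall i, 0 < l i -> C (p i)) -> C (\sum_i l i *: p i).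
Proof.
move=> /convex_setP cC l0 l1 Cp.
have [i li] : exists i, 0 < l i.
  apply: contrapT => /forallNP nl; move: l1; rewrite big1 => [/eqP|i _].
    by rewrite eq_sym oner_eq0.
  by apply/le_anti; rewrite l0 andbT leNgt; apply/negP.
suff step (r : seq I) (w : R) x : C x -> 0 <= w -> w + \sum_(j <- r) l j = 1 ->
    C (w *: x + \sum_(j <- r) l j *: p j).
  by have := step (index_enum I) 0 _ (Cp i li) (lexx _);
    rewrite scale0r !add0r; apply.
elim: r w x => [|j r IH] w x Cx w0.
  by rewrite !big_nil !addr0 => ->; rewrite scale1r.
rewrite !big_cons !addrA => wl.
have lj := l0 j; have [s0|s0] := eqVneq (w + l j) 0.
  have /eqP := s0; rewrite paddr_eq0// => /andP[/eqP w00 /eqP lj0].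
  have := IH 0 x Cx (lexx _); rewrite w00 lj0 !scale0r !add0r; apply.
  by rewrite -wl s0 add0r.
have sp : 0 < w + l j by rewrite lt_def s0 addr_ge0.
have [lj0|ljp] := eqVneq (l j) 0.
  by rewrite lj0 scale0r addr0; apply: IH => //; rewrite -wl lj0 addr0.
have {}ljp : 0 < l j by rewrite lt_def ljp.
have -> : w *: x + l j *: p j =
    (w + l j) *: ((w / (w + l j)) *: x + (1 - w / (w + l j)) *: p j).
  rewrite scalerDr !scalerA; congr (_ *: _ + _ *: _); by field.
apply: IH => //; last by rewrite addr_ge0.
apply: cC => //; last exact: Cp.
  by rewrite divr_ge0// ltW.
by rewrite ler_pdivrMr// mul1r lerDl.
Qed.

Lemma convex_conv_hull A : @convex_set R E (conv_hull A).
Proof.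
apply/convex_setP => x y t t0 t1 Ax Ay C [cC AC].
by move/convex_setP : (cC); apply=> //; [exact: Ax|exact: Ay].
Qed.

(** Gordan's alternative. If [p] is the point of smallest Euclidean norm in the
convex hull of the [c i] with [T i], then either [p] is zero, or moving from
[p] a little towards a [c i] with [dotp (c i) p <= 0] would decrease the norm,
so that [p] is the required direction. *)
Lemma gordan n (c : 'I_n -> E) (T : pred 'I_n) :
  (exists l : 'I_n -> R, [/\ forall i, 0 <= l i, forall i, ~~ T i -> l i = 0,
     \sum_i l i = 1 & \sum_i l i *: c i = 0]) \/
  (exists v, forall i, T i -> 0 < dotp (c i) v).
Proof.
have [[i0 Ti0]|T0] := pselect (exists i, T i); last first.
  by right; exists 0 => i Ti; case: T0; exists i.
pose comb (l : 'rV[R]_n) := \sum_i l ord0 i *: c i.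
pose K := [set l : 'rV[R]_n | forall i,
    (if T i then `[0, 1]%classic else [set 0]) (l ord0 i)] `&`
  [set l | dotp l (const_mx 1) = 1].
have sumE (l : 'rV[R]_n) : dotp l (const_mx 1) = \sum_i l ord0 i.
  by apply: eq_bigr => i _; rewrite mxE mulr1.
have Kdelta i : T i -> K (delta_mx ord0 i).
  move=> Ti; split=> [j|]/=.
    rewrite mxE/=; have [->|ji] := eqVneq j i.
      by rewrite Ti/= in_itv/= ler01 lexx.
    by case: ifP => //= _; rewrite in_itv/= lexx ler01.
  rewrite sumE (bigD1 i)//= mxE !eqxx big1 ?addr0// => j ji.
  by rewrite mxE (negbTE ji) andbF.
have cK : compact K.
  apply: compact_closedI.
    pose A i : set R := if T i then `[0, 1]%classic else [set 0].
    suff : forall i, compact (A i) by move=> /rV_compact; exact.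
    rewrite /A => i.
    case: ifP => _; first exact: segment_compact.
    exact: compact_set1.
  apply: (@closed_comp _ _ (fun l => dotp l (const_mx 1)) [set 1]).
    by move=> ? _; exact: dotpl_continuous.
  exact: closed_eq.
have fcont : continuous (fun l => dotp (comb l) (comb l)).
  move=> l.
  have cl : comb @ l --> comb l.
    apply: (@cvg_big _ _ _ _ _ add_continuous _ (nbhs l)) => i _.
    by apply: (@cvgZr_tmp _ _ _ (nbhs l)); exact: coord_continuous.
  exact: (@cvg_dotp _ _ _ (nbhs l) _ comb comb _ _ cl cl).
have [|l /set_mem Kl lmin] := EVT_min_rV _ cK (continuous_subspaceT fcont).
  by exists (delta_mx ord0 i0); exact: Kdelta.
have [/= lT l1] := Kl.
have [p0|p0] := eqVneq (comb l) 0.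
  left; exists (fun i => l ord0 i); split=> //.
  - by move=> i; have := lT i; case: ifP => /= _; [rewrite in_itv => /andP[]|move=> ->].
  - by move=> i /negbTE Ti; have := lT i; rewrite Ti.
  - by rewrite -sumE.
right; exists (comb l) => i Ti; rewrite ltNge; apply/negP => ip.
set p := comb l in p0 ip lmin *.
have q0 : 0 < dotp p p by exact: dotp_gt0.
have r0 := dotp_ge0 (c i - p).
(* This [t] makes the change of the squared norm at most [- t * dotp p p]. *)
have [t [t0 t1 tE]] : exists t, [/\ 0 < t, t <= 1 &
    t * (dotp p p + dotp (c i - p) (c i - p)) = dotp p p].
  exists (dotp p p / (dotp p p + dotp (c i - p) (c i - p))).
  have pr0 : 0 < dotp p p + dotp (c i - p) (c i - p) by rewrite ltr_wpDr.
  by rewrite divr_gt0// ler_pdivrMr// mul1r lerDl r0 divfK// gt_eqF.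
pose l' := t *: delta_mx ord0 i + (1 - t) *: l.
have Kl' : K l'.
  have [dT d1] := Kdelta i Ti; split=> [j|]/=; last first.
    by rewrite dotpDl !dotpZl d1 l1 !mulr1 subrKC.
  have := dT j; have := lT j; rewrite !mxE; case: ifP => _ /=.
    rewrite !in_itv/= => /andP[a0 a1] /andP[b0 b1]; apply/andP; split; first nra.
    nra.
  by move=> -> ->; rewrite !mulr0 addr0.
have combl' : comb l' = p + t *: (c i - p).
  rewrite /comb; under eq_bigr do rewrite !mxE scalerDl -!scalerA.
  rewrite big_split/= -!scaler_sumr -/(comb l) -/p (bigD1 i)//= eqxx big1 => [|j ji].
    by rewrite scale1r addr0 scalerBr scalerBl scale1r addrCA.
  by rewrite (negbTE ji) scale0r.
have := lmin l' (mem_set Kl'); rewrite combl'.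
move: tE r0; rewrite !(dotpDl, dotpDr, dotpZl, dotpZr, dotpNl, dotpNr, opprK).
rewrite (dotpC p (c i)).
set q := dotp p p in q0 *; set s := dotp (c i) p in ip *.
move=> tE r0; apply/negP; rewrite -ltNge.
nra.
Qed.

End Convexity.

(** * Relative interiors *)

Section RelativeInterior.
Context {R : realType} {d : nat}.
Local Notation E := 'rV[R]_d.
Implicit Types (x y z u v : E) (A C F : set E) (t : R).

Lemma affine_aff_hull A : affine_set (aff_hull A).
Proof. by move=> x y t Ax Ay C [cC AC]; apply: (cC); [exact: Ax|exact: Ay]. Qed.

Lemma relint_sub A : relint A `<=` A.
Proof. by move=> x [ax /nbhs_singleton]; apply. Qed.

(** Prolonging the segment from [y] to [z] does not leave the affine hull, in
which [z] has a neighbourhood contained in [A]. *)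
Lemma relint_extend A z y : relint A z -> A y ->
  exists2 e, 0 < e & A (z + e *: (z - y)).
Proof.
move=> zA Ay; have [za /(nbhs_line (z - y))[e e0 /(_ e)]] := zA.
rewrite gtr0_norm// => /(_ (lexx _)) Ae; exists e => //; apply: Ae.
have -> : z + e *: (z - y) = (1 + e) *: z + (1 - (1 + e)) *: y.
  by apply/rowP => i; rewrite !mxE; ring.
by apply: affine_aff_hull => //; exact: sub_gen_smallest.
Qed.

(** If some point of [A] had a smaller value, prolonging the segment from it
through [z] would exceed the maximum. *)
Lemma relint_argmax A z u : relint A z ->
  (forall y, A y -> dotp y u <= dotp z u) ->
  forall y, A y -> dotp y u = dotp z u.
Proof.
move=> zA zmax y Ay; apply/le_anti; rewrite zmax//=.
have [e e0 /zmax] := relint_extend zA Ay.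
by rewrite dotpDl dotpZl dotpBl gerDl pmulr_rle0// subr_le0.
Qed.

(** The homothety with centre [z] that takes [z + t *: (y - z)] to [y] preserves
the affine hull, so its inverse turns a neighbourhood of [y] in [C] into a
neighbourhood of [z + t *: (y - z)] in [C]. *)
Lemma relint_segment C z y t : @convex_set R E C -> C z -> relint C y ->
  0 < t -> t <= 1 -> relint C (z + t *: (y - z)).
Proof.
move=> /convex_setP cC Cz yC t0 t1; have [ya Cy] := yC.
have aC := @sub_gen_smallest _ affine_set C.
have aff x w s : aff_hull C x -> aff_hull C w -> aff_hull C (w + s *: (x - w)).
  move=> ax aw; have -> : w + s *: (x - w) = s *: x + (1 - s) *: w.
    by rewrite scalerBr scalerBl scale1r addrCA.
  exact: affine_aff_hull.
split; first by apply: aff => //; exact: aC.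
pose g x := z + t^-1 *: (x - z).
have gy : g (z + t *: (y - z)) = y.
  by rewrite /g addrAC subrr add0r scalerA mulVf ?gt_eqF// scale1r subrKC.
have cg : g x @[x --> nbhs (z + t *: (y - z))] --> g (z + t *: (y - z)).
  pose p := z + t *: (y - z); rewrite -/p.
  apply: (@cvgD _ _ _ (nbhs p) _ _ _ _ _ (cvg_cst z)).
  apply: (@cvgZl_tmp _ _ _ (nbhs p)).
  exact: (@cvgB _ _ _ (nbhs p) _ _ _ _ _ cvg_id (cvg_cst z)).
rewrite gy in cg.
have gC : \forall x \near z + t *: (y - z), aff_hull C (g x) -> C (g x).
  exact: (cg _ Cy).
near=> x => ax.
have -> : x = t *: g x + (1 - t) *: z.
  rewrite /g scalerDr scalerA mulfV ?gt_eqF// scale1r scalerBl scale1r.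
  by rewrite addrC addrA subrK subrKC.
apply: cC => //; first exact: ltW.
by apply: (near gC) => //; apply: aff => //; exact: aC.
Unshelve. all: by end_near. Qed.

(** A maximal linearly independent family of differences [c - c0] with
    [c] in [C] spans the direction of [C], so that the barycentric coordinates
    of a point of the affine hull depend continuously on it. *)
Lemma relint_nonempty C : @convex_set R E C -> C !=set0 -> relint C !=set0.
Proof.
move=> cC [c0 Cc0].
pose indep k := `[< exists M : 'M[R]_(k, d),
  row_free M /\ forall i, C (c0 + row i M) >].
have indep0 : exists k, indep k.
  exists 0%N; apply/asboolP; exists 0; split; last by case.
  by rewrite /row_free mxrank0.
have indep_le k : indep k -> (k <= d)%N.
  by move=> /asboolP[M [/eqP kE _]]; have := rank_leq_col M; rewrite kE.
case: (ex_maxnP indep0 indep_le) => k /asboolP[M [Mfree CM]] kmax.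
have span c : C c -> (c - c0 <= M)%MS.
  move=> Cc; apply/negPn/negP => cM.
  suff /kmax : indep (k + 1)%N by rewrite addn1 ltnn.
  apply/asboolP; exists (col_mx M (c - c0)); split=> [|i]; last first.
    case: (fintype.splitP i) => j ij.
      have -> : i = lshift 1 j by exact/val_inj.
      by rewrite rowKu.
    have -> : i = rshift k j by exact/val_inj.
    by rewrite rowKd row_id subrKC.
  rewrite /row_free eqn_leq rank_leq_row /= -addsmxE.
  rewrite [leqLHS]addn1 -[X in (X < _)%N](eqP Mfree).
  rewrite ltn_neqAle mxrankS ?addsmxSl// andbT.
  apply: contra cM => /eqP rk; rewrite (submx_trans (addsmxSr M _))//.
  have := mxrank_leqif_sup (addsmxSl M (c - c0)).
  by move=> [_ <-]; rewrite rk.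
have affspan y : aff_hull C y -> (y - c0 <= M)%MS.
  move=> /(_ [set y | (y - c0 <= M)%MS]); apply; split=> // x w t /= xM wM.
  have -> : t *: x + (1 - t) *: w - c0 = t *: (x - c0) + (1 - t) *: (w - c0).
    rewrite !scalerBr addrACA -opprD -scalerDl subrKC scale1r.
    by [].
  by rewrite addmx_sub// scalemx_sub.
(* [k] coordinates bounded by [s] have sum at most 1, and [p] has all its
   coordinates in the middle of the interval from 0 to [s]. *)
pose s : R := (k.+1)%:R^-1.
have s0 : 0 < s by rewrite invr_gt0 ltr0n.
pose coord y i := ((y - c0) *m pinvmx M) ord0 i.
pose p := c0 + \sum_i (s / 2) *: row i M.
have aff_comb (l : 'I_k -> R) :
    c0 + \sum_i l i *: row i M = \sum_i l i *: (c0 + row i M) + (1 - \sum_i l i) *: c0.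
  under [in RHS]eq_bigr do rewrite scalerDr.
  by rewrite big_split/= -scaler_suml scalerBl scale1r [RHS]addrC addrA subrK.
have inC (l : 'I_k -> R) : (forall i, 0 <= l i <= s) ->
    C (c0 + \sum_i l i *: row i M).
  move=> ls.
  have sum1 : \sum_i l i <= 1.
    rewrite (@le_trans _ _ (\sum_(i < k) s))//.
      by apply: ler_sum => i _; have /andP[] := ls i.
    rewrite sumr_const card_ord -[s *+ k]mulr_natr mulrC ler_pdivrMr ?ltr0n//.
    by rewrite mul1r ler_nat.
  rewrite aff_comb.
  pose l' (o : 'I_k.+1) :=
    if unlift ord0 o is Some i then l i else 1 - \sum_i l i.
  pose c' (o : 'I_k.+1) :=
    if unlift ord0 o is Some i then c0 + row i M else c0.
  have -> : \sum_i l i *: (c0 + row i M) + (1 - \sum_i l i) *: c0 =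
      \sum_o l' o *: c' o.
    rewrite big_ord_recl /l' /c' unlift_none addrC; congr (_ + _).
    by apply: eq_bigr => i _; rewrite liftK.
  apply: convex_sum => //.
  - move=> o; rewrite /l'; case: unliftP => [i _|_]; last by rewrite subr_ge0.
    by have /andP[] := ls i.
  - rewrite big_ord_recl /l' unlift_none -[RHS](subrK (\sum_i l i)).
    by congr (_ + _); apply: eq_bigr => i _; rewrite liftK.
  - by move=> o _; rewrite /c'; case: unliftP => [i _|_].
have coordE y : (y - c0 <= M)%MS -> y = c0 + \sum_i coord y i *: row i M.
  move=> yM; rewrite -[LHS](subrKC c0) -{1}(mulmxKpV yM) mulmx_sum_row.
  by [].
exists p; split.
  apply: sub_gen_smallest; rewrite /p; apply: inC => i.
  by apply/andP; split; lra.
have coordp i : coord p i = s / 2.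
  rewrite /coord /p addrAC subrr add0r -scaler_sumr.
  have -> : \sum_i row i M = (const_mx 1 : 'rV_k) *m M.
    by rewrite mulmx_sum_row; apply: eq_bigr => j _; rewrite mxE scale1r.
  by rewrite scalemxAl mulmxKp// !mxE mulr1.
have near_coord : \forall y \near p, forall i, 0 < coord y i < s.
  apply: (@filter_forall _ _ (fun i y => 0 < coord y i < s) (nbhs p)) => i.
  pose n : 'rV[R]_d := (col i (pinvmx M))^T.
  have coordn y : coord y i = dotp y n - dotp c0 n.
    by rewrite -dotpBl /coord mxE; apply: eq_bigr => j _; rewrite !mxE.
  have := coordp i; rewrite coordn => pn.
  near=> y; rewrite coordn subr_gt0 ltrBlDr; apply/andP; split; near: y.
    by apply: (cvgr_gt _ (dotpl_continuous (x := p))); lra.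
  by apply: (cvgr_lt _ (dotpl_continuous (x := p))); lra.
near=> y => ay; rewrite (coordE y (affspan y ay)); apply: inC => i.
suff : 0 < coord y i < s by move=> /andP[/ltW-> /ltW->].
by move: i; near: y.
Unshelve. all: by end_near. Qed.

End RelativeInterior.

(** * Images of standard-form polyhedra *)

Section StandardForm.
Context {R : realType}.

(** The ratio test of the simplex method: from [l], walk along [g] until the
    first coordinate vanishes. *)
Lemma ratio_test (I : finType) (l g : I -> R) :
  (forall i, 0 <= l i) -> (forall i, l i = 0 -> g i = 0) ->
  (exists i, g i < 0) ->
  exists2 t, 0 < t & (forall i, 0 <= l i + t * g i) /\
    exists2 i, l i != 0 & l i + t * g i = 0.
Proof.
move=> l0 lg [i0 gi0].
have lpos i : g i < 0 -> 0 < l i.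
  move=> gi; rewrite lt_def l0 andbT; apply: contraTneq gi => /lg ->.
  by rewrite ltxx.
case: (@Order.TotalTheory.arg_minP _ _ I i0 (fun i => g i < 0)
  (fun i => l i / - g i) gi0) => i gi imin.
have tp : 0 < l i / - g i by rewrite divr_gt0 ?lpos// oppr_gt0.
exists (l i / - g i) => //; split=> [j|]; last first.
  exists i; first by rewrite gt_eqF// lpos.
  by field; rewrite lt_eqF.
have [gj|gj] := ltP (g j) 0; last by rewrite addr_ge0// mulr_ge0// ltW.
have := imin j gj; rewrite ler_pdivlMr ?oppr_gt0// => h; nra.
Qed.

(** A point [l] of the polyhedron is basic if it is the only point whose support
is contained in that of [l]. From a point that is not basic one can walk along
a line in both directions until the support shrinks, and the point lies between
the two ends; so every point is obtained from basic points by convex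
combinations. *)
Lemma basic_point_induction (I : finType) (L : set (I -> R))
    (Q : set (I -> R)) :
  (forall l l' t, L l -> L l' -> L (fun i => t * l i + (1 - t) * l' i)) ->
  (forall l, L l -> (forall i, 0 <= l i) -> forall i, l i <= 1) ->
  (forall l l' t, 0 <= t -> t <= 1 -> Q l -> Q l' ->
     Q (fun i => t * l i + (1 - t) * l' i)) ->
  (forall l, L l -> (forall i, 0 <= l i) ->
     (forall l', L l' -> (forall i, 0 <= l' i) ->
        (forall i, l i = 0 -> l' i = 0) -> l' = l) -> Q l) ->
  forall l, L l -> (forall i, 0 <= l i) -> Q l.
Proof.
move=> Laff Lbd Qconv Qbasic l.
have [n] := ubnP #|[pred i | l i != 0]|; elim: n l => // n IH l ln Ll l0.
have [/(Qbasic l Ll l0)//|] := pselect (forall l', L l' ->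
  (forall i, 0 <= l' i) -> (forall i, l i = 0 -> l' i = 0) -> l' = l).
move=> /existsNP[l' /not_implyP[Ll' /not_implyP[l'0 /not_implyP[l'l ll']]]].
pose g i := l' i - l i.
have Lg t : L (fun i => l i + t * g i).
  have -> : (fun i => l i + t * g i) = (fun i => t * l' i + (1 - t) * l i).
    by apply/funext => i; rewrite /g; ring.
  exact: Laff.
have g0 : exists i, g i != 0.
  apply: contrapT => /forallNP gn; apply: ll'; apply/funext => i.
  by apply/eqP; rewrite -subr_eq0; apply/negPn/negP/gn.
have lg i : l i = 0 -> g i = 0 by move=> li; rewrite /g l'l// li subrr.
(* Boundedness stops the walk in both directions, [e = 1] and [e = - 1]. *)
have stop e : e != 0 -> exists2 t, 0 < t & Q (fun i => l i + t * (e * g i)).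
  move=> e0; have [||t t0 [tl [i li ti]]] := @ratio_test I l (fun i => e * g i) l0.
  - by move=> i /lg ->; rewrite mulr0.
  - apply: contrapT => /forallNP ge; have [i gi] := g0.
    have gep j : 0 <= e * g j by rewrite leNgt; apply/negP/ge.
    have egi : 0 < e * g i by rewrite lt_def gep mulf_neq0.
    (* This step would add 2 to the coordinate [i], which is bounded by 1. *)
    have tE : 2 / (e * g i) * e * g i = 2.
      by rewrite -mulrA divfK// gt_eqF.
    have : l i + 2 / (e * g i) * e * g i <= 1.
      apply: (@Lbd _ (Lg (2 / (e * g i) * e))) => j.
      by rewrite -(mulrA _ e) addr_ge0// mulr_ge0// divr_ge0// ltW.
    by apply/negP; rewrite -ltNge tE ltr_wpDl// ltr1n.
  exists t => //; apply: IH => //; last first.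
    have -> : (fun i => l i + t * (e * g i)) = (fun i => l i + (t * e) * g i).
      by apply/funext => j; rewrite mulrA.
    exact: Lg.
  rewrite -ltnS (leq_trans _ ln)// ltnS proper_card//; apply/properP; split.
    apply/fintype.subsetP => j; rewrite !inE; apply: contra => /eqP lj.
    by rewrite lj lg// !mulr0 addr0.
  by exists i; rewrite !inE// ti eqxx.
have [t1 t10 Q1] := stop 1 (oner_neq0 _).
have [|t2 t20 Q2] := stop (- 1); first by rewrite oppr_eq0 oner_neq0.
have -> : l = (fun i => (t2 / (t1 + t2)) * (l i + t1 * (1 * g i)) +
    (1 - t2 / (t1 + t2)) * (l i + t2 * (- 1 * g i))).
  by apply/funext => i; field; rewrite gt_eqF// addr_gt0.
apply: Qconv => //; first by rewrite divr_ge0// ?addr_ge0// ltW.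
by rewrite ler_pdivrMr ?addr_gt0// mul1r lerDr ltW.
Qed.

(** A basic point is determined by its support, so there are finitely many of
them, and their images generate the image of the polyhedron. *)
Lemma polytope_image (d : nat) (I : finType) (L : set (I -> R))
    (p : I -> 'rV[R]_d) :
  (forall l l' t, L l -> L l' -> L (fun i => t * l i + (1 - t) * l' i)) ->
  (forall l, L l -> (forall i, 0 <= l i) -> forall i, l i <= 1) ->
  polytope [set \sum_i l i *: p i | l in [set l | L l /\ forall i, 0 <= l i]].
Proof.
move=> Laff Lbd.
pose basic l := [/\ L l, forall i, 0 <= l i &
  forall l', L l' -> (forall i, 0 <= l' i) ->
    (forall i, l i = 0 -> l' i = 0) -> l' = l].
pose supp (l : I -> R) := [set i | l i != 0]%SET.
pose comb (l : I -> R) := \sum_i l i *: p i.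
have combD (l l' : I -> R) (t : R) : comb (fun i => t * l i + (1 - t) * l' i) =
    t *: comb l + (1 - t) *: comb l'.
  rewrite /comb !scaler_sumr -big_split/=; apply: eq_bigr => i _.
  by apply/rowP => j; rewrite !mxE; ring.
have basic_inj l l' : basic l -> basic l' -> supp l = supp l' -> l = l'.
  move=> [Ll l0 lu] [Ll' l'0 l'u] /setP ss; apply: l'u => // i li.
  by apply/eqP; have := ss i; rewrite !inE li eqxx => /negbFE.
pose V := [set comb l | l in basic].
have Vfin : finite_set V.
  apply: finite_image.
  pose pick s := xget (fun=> 0) [set l | basic l /\ supp l = s].
  apply: (@sub_finite_set _ _ (pick @` setT)); last first.
    exact/finite_image/finite_finset.
  move=> l bl; exists (supp l) => //; rewrite /pick.
  by case: xgetP => [l' _ [bl' /basic_inj ->]|/(_ l)[]].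
exists V => //; apply/seteqP; split.
  move=> _ [l [Ll l0] <-]; rewrite -/(comb l).
  pose Q := [set l | conv_hull V (comb l)].
  suff : Q l by [].
  apply: (@basic_point_induction _ L Q) => // {l Ll l0} [l l' t t0 t1 Ql Ql'|l Ll l0 lu].
    rewrite /Q /= combD; have /convex_setP := @convex_conv_hull R d V; exact.
  by apply: sub_gen_smallest; exists l.
apply: smallest_sub => [|_ [l [Ll l0 _] <-]]; last by exists l.
apply/convex_setP => _ _ t t0 t1 [l [Ll l0] <-] [l' [Ll' l'0] <-].
exists (fun i => t * l i + (1 - t) * l' i); last exact: combD.
split=> [|i]; first exact: Laff.
by rewrite addr_ge0// mulr_ge0// subr_ge0.
Qed.

End StandardForm.

(** * Depth regions of weighted points *)

Section Region.
Context {R : realType} {d n : nat}.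
Local Notation E := 'rV[R]_d.
Variables (a : 'I_n -> E) (w : 'I_n -> R) (alpha : R).
Hypothesis w_gt0 : forall i, 0 < w i.
Implicit Types (x y z u v : E) (T : pred 'I_n) (t : R).

Definition weight T : R := \sum_(i | T i) w i.

Lemma weight_le T T' : (forall i, T i -> T' i) -> weight T <= weight T'.
Proof.
move=> TT'; rewrite /weight big_mkcond [leRHS]big_mkcond; apply: ler_sum => i _.
by have := TT' i; case: (T i) => [->//|_]; case: ifP => // _; exact: ltW.
Qed.

(** The central region; allowing all nonzero directions instead of unit vectors
avoids normalizing the directions constructed below. *)
Definition region : set E := [set x | forall u, u != 0 ->
  alpha <= weight (fun i => dotp x u <= dotp (a i) u)].

Definition light x u : Prop := weight (fun i => dotp x u < dotp (a i) u) < alpha.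

Lemma notin_region x : ~ region x -> exists2 u, u != 0 &
  weight (fun i => dotp x u <= dotp (a i) u) < alpha.
Proof.
by move=> /existsNP[u /not_implyP[u0 /negP]]; rewrite -ltNge; exists u.
Qed.

(** A point of the region in the open halfspace would have a closed halfspace
inside the open one, of weight below [alpha]. *)
Lemma light_region x y u : u != 0 -> light x u -> region y ->
  dotp y u <= dotp x u.
Proof.
move=> u0 xl Dy; rewrite leNgt; apply/negP => xy; have := Dy u u0.
rewrite leNgt => /negP; apply; apply: le_lt_trans xl.
by apply: weight_le => i; exact: lt_le_trans.
Qed.

Lemma weight_scale x u c : 0 < c ->
  weight (fun i => dotp x (c *: u) <= dotp (a i) (c *: u)) =
  weight (fun i => dotp x u <= dotp (a i) u).
Proof. by move=> c0; apply: eq_bigl => i; rewrite !dotpZr ler_pM2l. Qed.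

Lemma normalize u : u != 0 -> exists2 c, 0 < c & sphere (c *: u).
Proof.
move=> /dotp_gt0 u0; exists (Num.sqrt (dotp u u))^-1.
  by rewrite invr_gt0 sqrtr_gt0.
apply/sphereP; rewrite dotpZl dotpZr mulrA -expr2 exprVn sqr_sqrtr ?ltW//.
by rewrite mulVf// gt_eqF.
Qed.

Lemma closed_region : closed region.
Proof.
have -> : region = \bigcap_(u in [set u | u != 0])
    [set x | alpha <= weight (fun i => dotp x u <= dotp (a i) u)].
  by apply/seteqP; split=> x Dx u; exact: Dx.
apply: closed_bigI => u _; rewrite -[X in closed X]setCK; apply: open_closedC.
rewrite openE => x /= /negP; rewrite -ltNge => xl.
have near_x : \forall y \near x, forall i, dotp (a i) u < dotp x u ->
    dotp (a i) u < dotp y u.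
  apply: (@filter_forall _ _ (fun i y => dotp (a i) u < dotp x u ->
    dotp (a i) u < dotp y u) (nbhs x)) => i.
  have [ix|ix] := boolP (dotp (a i) u < dotp x u); last by near=> y => /negP.
  by near=> y => _; near: y; exact: (cvgr_gt _ (dotpl_continuous (x := x))).
rewrite /interior; near=> y; apply/negP; rewrite -ltNge.
apply: le_lt_trans xl; apply: weight_le => i; apply: contraTT.
by rewrite -!ltNge; move: i; near: y.
Unshelve. all: by end_near. Qed.

(** Near [(x, u)] no atom of the open halfspace leaves it, so the pairs that are
not light form an open set; compactness of the sphere allows to project the
closed set of light pairs. *)
Lemma closed_light (Q : set E) : closed Q ->
  closed [set x | exists u, [/\ sphere u, Q u & light x u]].
Proof.
move=> cQ; rewrite -[X in closed X]setCK; apply: open_closedC.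
rewrite openE => x /= nSx.
have /compact_near_coveringP := @compact_sphere R d.
move=> /(_ _ (nbhs x) (fun y u => ~ (Q u /\ light y u)) _) cover.
have /cover : forall u, sphere u ->
    \forall v \near u & y \near x, ~ (Q v /\ light y v).
  move=> u su; have [Qu|nQu] := pselect (Q u); last first.
    have oQ : open (~` Q) by exact: closed_openC.
    exists (~` Q, setT); last by move=> p [/= nQ _] [].
    by split; [exact: open_nbhs_nbhs|exact: filterT].
  have xu : alpha <= weight (fun i => dotp x u < dotp (a i) u).
    by rewrite leNgt; apply/negP => xl; apply: nSx; exists u.
  have near_xu : \forall p \near filter_prod (nbhs u) (nbhs x), forall i,
      dotp x u < dotp (a i) u -> dotp p.2 p.1 < dotp (a i) p.1.
    apply: filter_forall => i.
    have [ix|ix] := boolP (dotp x u < dotp (a i) u); last by near=> p => /negP.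
    have : dotp (p.2 - a i) p.1 @[p --> filter_prod (nbhs u) (nbhs x)] -->
        dotp (x - a i) u.
      apply: cvg_dotp; last exact: cvg_fst.
      by apply: cvgB; [exact: cvg_snd|exact: cvg_cst].
    move=> /cvgr_lt /(_ 0); rewrite dotpBl subr_lt0 => /(_ ix) H.
    by near=> p => _; rewrite -subr_lt0 -dotpBl; near: p.
  near=> p => -[_]; rewrite /light; apply/negP; rewrite -leNgt.
  apply: (le_trans xu); apply: weight_le; near: p; exact: near_xu.
rewrite /interior => H; near=> y => -[u [su Qu yl]].
suff : ~ (Q u /\ light y u) by apply.
by move: su; apply: (near H y).
Unshelve. all: by end_near. Qed.

End Region.

(** * Light halfspaces at boundary points of the region *)

Section Supporting.
Context {R : realType} {d n : nat}.
Local Notation E := 'rV[R]_d.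
Variables (a : 'I_n -> E) (w : 'I_n -> R) (alpha : R).
Hypothesis w_gt0 : forall i, 0 < w i.
Implicit Types (x y z u v : E) (T : pred 'I_n) (t : R).
Local Notation D := (region a w alpha).
Local Notation light := (light a w alpha).
Local Notation weight := (weight w).

Lemma notin_region_sphere x : ~ D x ->
  exists2 u, sphere u & weight (fun i => dotp x u <= dotp (a i) u) < alpha.
Proof.
move=> /notin_region[u u0 xu]; have [c c0 su] := normalize u0.
by exists (c *: u) => //; rewrite weight_scale.
Qed.

Lemma light_of_closed x u : weight (fun i => dotp x u <= dotp (a i) u) < alpha ->
  light x u.
Proof. by apply: le_lt_trans; apply: (weight_le w_gt0) => i; exact: ltW. Qed.

Lemma light_of_boundary x : ~ D° x -> exists2 u, sphere u & light x u.
Proof.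
move=> nx; have : closure (~` D) x by rewrite closure_setC.
have : ~` D `<=` [set x | exists u, [/\ sphere u, setT u & light x u]].
  by move=> y /notin_region_sphere[u su /light_of_closed]; exists u.
move=> /closureS /[apply].
rewrite -(closure_id _).1; last by apply: closed_light => //; exact: closedT.
by move=> [u [su _ xu]]; exists u.
Qed.

(** The points [z + t *: v] have closed halfspaces of weight below [alpha] that
miss [z], whose directions therefore have a positive product with [v]; pass to
the limit. *)
Lemma light_of_direction z v : D z ->
  (forall t, 0 < t -> t <= 1 -> ~ D (z + t *: v)) ->
  exists u, [/\ sphere u, 0 <= dotp v u & light z u].
Proof.
move=> Dz nD.
pose S := [set x | exists u, [/\ sphere u, [set u | 0 <= dotp v u] u & light x u]].
suff : closure S z.
  rewrite -(closure_id _).1//; apply: closed_light => //.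
  apply: (@closed_comp _ _ (fun u => dotp v u) [set t | 0 <= t]).
    move=> u _; under eq_fun do rewrite dotpC; exact: dotpl_continuous.
  exact: closed_ge.
move=> B /(nbhs_line v)[e e0 eB].
pose t := Num.min e 1.
have t0 : 0 < t by rewrite lt_min e0 ltr01.
have t1 : t <= 1 by rewrite ge_min lexx orbT.
have te : t <= e by rewrite ge_min lexx.
exists (z + t *: v); split; last by apply: eB; rewrite gtr0_norm.
have [u su xu] := notin_region_sphere (nD t t0 t1); exists u; split=> //; last first.
  exact: light_of_closed.
rewrite /= leNgt; apply/negP => vu.
have := Dz u (sphere_neq0 su); rewrite leNgt => /negP; apply.
apply: le_lt_trans xu; apply: (weight_le w_gt0) => i; apply: le_trans.
by rewrite dotpDl dotpZl gerDl pmulr_rle0// ltW.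
Qed.

(** Otherwise some [v] separates [y] strictly from the atoms in the hyperplane.
Tilting [u] to [u + e *: v] about [y] with a small [e] then expels these atoms
and lets no new atom in, so that [y] has a closed halfspace of weight below
[alpha]. *)
Lemma hull_of_light z u y : u != 0 -> light z u -> D y -> dotp y u = dotp z u ->
  exists l : 'I_n -> R, [/\ forall i, 0 <= l i,
    forall i, dotp (a i) u != dotp z u -> l i = 0,
    \sum_i l i = 1 & \sum_i l i *: a i = y].
Proof.
move=> u0 zl Dy yz.
have [[l [l0 lT l1 ly]]|[v yv]] :=
    gordan (fun i => y - a i) (fun i => dotp (a i) u == dotp z u).
  exists l; split=> //; apply/esym/subr0_eq; rewrite -[RHS]ly.
  under [RHS]eq_bigr do rewrite scalerBr.
  by rewrite big_split/= sumrN -scaler_suml l1 scale1r.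
exfalso.
pose A := [set u' | 0 < dotp u' u /\
  forall i, dotp (a i - y) u < 0 -> dotp (a i - y) u' < 0].
have : nbhs u A.
  have near_u : \forall u' \near u, forall i, dotp (a i - y) u < 0 ->
      dotp u' (a i - y) < 0.
    apply: (@filter_forall _ _ (fun i u' => dotp (a i - y) u < 0 ->
      dotp u' (a i - y) < 0) (nbhs u)) => i.
    have [iu|iu] := boolP (dotp (a i - y) u < 0); last by near=> u' => /negP.
    near=> u' => _; near: u'; apply: (cvgr_lt _ (dotpl_continuous (x := u))).
    by rewrite dotpC.
  rewrite /A; near=> u'; split.
    by near: u'; apply: (cvgr_gt _ (dotpl_continuous (x := u))); exact: dotp_gt0.
  by move=> i; rewrite (dotpC _ u'); move: i; near: u'.
move=> /(nbhs_line v)[e e0 /(_ e)]; rewrite gtr0_norm// => /(_ (lexx _))[uu iu].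
have /Dy : u + e *: v != 0.
  by apply: contraTneq uu => ->; rewrite dotp0l ltxx.
rewrite leNgt => /negP; apply; apply: le_lt_trans zl.
apply: (weight_le w_gt0) => i; apply: contraTT; rewrite -leNgt le_eqVlt => /orP[iz|iz].
  rewrite -ltNge -subr_gt0 -dotpBl dotpDr dotpZr.
  have -> : dotp (y - a i) u = 0 by rewrite dotpBl yz (eqP iz) subrr.
  by rewrite add0r mulr_gt0// yv.
rewrite -ltNge -subr_lt0 -dotpBl; apply: iu.
by rewrite dotpBl yz subr_lt0.
Unshelve. all: by end_near. Qed.

(** If a functional that is constant on the atoms had a larger value at a point
of the region, some closed halfspace at that point would contain no atom. *)
Lemma span_region z y v : 0 < alpha -> D y ->
  (forall i, dotp (a i - z) v = 0) -> dotp (y - z) v = 0.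
Proof.
move=> alpha0 Dy.
suff nlt v' : (forall i, dotp (a i - z) v' = 0) -> dotp (y - z) v' <= 0.
  move=> av; apply/le_anti; rewrite nlt//= -oppr_le0 -dotpNr nlt// => i.
  by rewrite dotpNr av oppr0.
move=> av; rewrite leNgt; apply/negP => yv.
have /Dy : v' != 0 by apply: contraTneq yv => ->; rewrite dotpC dotp0l ltxx.
rewrite leNgt => /negP; apply; rewrite /weight big_pred0// => i.
apply/negbTE; rewrite -ltNge -subr_gt0.
have := av i; rewrite !dotpBl in yv * => /subr0_eq ->.
by [].
Qed.

Lemma exists_notin_region : (0 < d)%N -> 0 < alpha -> exists x, ~ D x.
Proof.
move=> /(@exists_neq0 R)[u u0] alpha0; have uu := dotp_gt0 u0.
exists (((1 + \sum_i `|dotp (a i) u|) / dotp u u) *: u) => /(_ u u0).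
apply/negP; rewrite -ltNge /weight big_pred0// => i.
apply/negbTE; rewrite -ltNge dotpZl divfK ?gt_eqF//.
rewrite (bigD1 i)//= (le_lt_trans (ler_norm _))// addrCA ltrDl.
by rewrite ltr_wpDr// sumr_ge0.
Qed.

(** The parameters of the points of the region on the segment from [z] to [x]
form a compact set, whose maximum is [s]. *)
Lemma last_point z x : D z -> ~ D x ->
  exists s, [/\ 0 <= s, D (z + s *: (x - z)) &
  forall t, 0 < t -> t <= 1 ->
    ~ D (z + s *: (x - z) + t *: (x - (z + s *: (x - z))))].
Proof.
move=> Dz nDx.
pose K := `[0, 1]%classic `&` [set s : R | D (z + s *: (x - z))].
have cK : compact K.
  apply: compact_closedI; first exact: segment_compact.
  apply: (@closed_comp _ _ (fun s : R => z + s *: (x - z)) D).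
    move=> s _; apply: (@cvgD _ _ _ (nbhs s) _ _ _ _ _ (cvg_cst z)).
    by apply: cvgZr_tmp; exact: cvg_id.
  exact: closed_region.
have K0 : K !=set0.
  exists 0; split; first by rewrite /= in_itv/= lexx ler01.
  by rewrite /= scale0r addr0.
have idc : {within K, continuous (id : R -> R)}.
  by apply: continuous_subspaceT => s; exact: cvg_id.
have [s /set_mem[/= s01 Ds] smax] := compact_EVT_max K0 cK idc.
have [s0 s1] : 0 <= s /\ s <= 1 by apply/andP; rewrite in_itv in s01.
exists s; split=> // t t0 t1 Dt.
have {}s1 : s < 1.
  rewrite lt_neqAle s1 andbT; apply/eqP => s1E; apply: nDx.
  by move: Ds; rewrite s1E scale1r subrKC.
have : s + t * (1 - s) <= s.
  apply: smax; apply/mem_set; split; first by rewrite /= in_itv/=; apply/andP; split; nra.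
  rewrite /=; suff -> : z + (s + t * (1 - s)) *: (x - z) =
    z + s *: (x - z) + t *: (x - (z + s *: (x - z))) by [].
  by apply/rowP => i; rewrite !mxE; ring.
by apply/negP; rewrite -ltNge ltrDl mulr_gt0// subr_gt0.
Qed.

End Supporting.

(** * Rotating a supporting hyperplane *)

Section Orthogonality.
Context {R : realType} {d : nat}.
Local Notation E := 'rV[R]_d.

Lemma dotpE (x v : E) : dotp x v = (x *m v^T) ord0 ord0.
Proof. by rewrite mxE; apply: eq_bigr => i _; rewrite mxE. Qed.

Lemma orthogonal_submx m (M : 'M[R]_(m, d)) (x v : E) :
  (x <= M)%MS -> (forall i, dotp (row i M) v = 0) -> dotp x v = 0.
Proof.
move=> /submxP[c ->] Mv; rewrite dotpE -mulmxA.
suff -> : M *m v^T = 0 by rewrite mulmx0 mxE.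
apply/matrixP => i j; rewrite [j]ord1 [RHS]mxE -(Mv i) dotpE !mxE.
by apply: eq_bigr => k _; rewrite !mxE.
Qed.

Lemma orthogonal_witness m (M : 'M[R]_(m, d)) (x : E) : ~~ (x <= M)%MS ->
  exists2 v, forall i, dotp (row i M) v = 0 & dotp x v != 0.
Proof.
rewrite submxE => /eqP xM.
have [j xj] : exists j, (x *m cokermx M) ord0 j != 0.
  apply: contrapT => /forallNP nj; apply: xM; apply/rowP => j; rewrite [RHS]mxE.
  by apply/eqP/negPn/negP/nj.
have colE (y : E) : dotp y (col j (cokermx M))^T = (y *m cokermx M) ord0 j.
  by rewrite mxE; apply: eq_bigr => k _; rewrite !mxE.
exists (col j (cokermx M))^T; last by rewrite colE.
by move=> i; rewrite colE -row_mul mulmx_coker !mxE.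
Qed.

Lemma exists_notin_submx m p (M : 'M[R]_(m, d)) (N : 'M[R]_(p, d)) :
  (\rank M < \rank N)%N -> exists i, ~~ (row i N <= M)%MS.
Proof.
move=> MN; apply/row_subPn; apply: contraL MN => /mxrankS.
by rewrite -leqNgt.
Qed.

End Orthogonality.

Section Rotation.
Context {R : realType} {d n : nat}.
Local Notation E := 'rV[R]_d.
Variables (a : 'I_n -> E) (w : 'I_n -> R) (alpha : R).
Hypothesis w_gt0 : forall i, 0 < w i.
Implicit Types (x y z u v : E) (t : R).
Local Notation D := (region a w alpha).
Local Notation light := (light a w alpha).

Definition spread_mx z : 'M[R]_(n, d) := \matrix_i (a i - z).

Definition touch_mx z u : 'M[R]_(n, d) :=
  \matrix_i (if dotp (a i) u == dotp z u then a i - z else 0).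

(** Rotation is possible along a direction [v] that fixes the atoms in the
hyperplane, moves some other atom, and is not a multiple of [u]. The bound
[d.-1] on the rank provides [w1] orthogonal to [u] and to the atoms in the
hyperplane, the bound by the rank of all atoms provides [v0] that moves an
atom; one of [v0], [w1] and [v0 + w1] has all three properties. *)
Lemma rotation_axis z u : u != 0 ->
  (\rank (touch_mx z u) < minn (\rank (spread_mx z)) d.-1)%N ->
  exists v, [/\ forall i, dotp (row i (touch_mx z u)) v = 0,
    exists i, dotp (a i - z) v != 0 & forall t, u + t *: v != 0].
Proof.
move=> u0; rewrite leq_min => /andP[rs rd].
set M := touch_mx z u in rs rd *.
have [e eM] : exists e, ~~ (row e (1%:M : 'M[R]_d) <= (M + u)%MS)%MS.
  apply: exists_notin_submx; rewrite mxrank1.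
  have [+ _] := mxrank_adds_leqif M u; move=> /leq_ltn_trans; apply.
  have := rank_leq_row u; lia.
have [w1 w1M w1e] := orthogonal_witness eM.
have w1Mi i : dotp (row i M) w1 = 0.
  by apply: (orthogonal_submx _ w1M); rewrite (submx_trans (row_sub i M))// addsmxSl.
have w1u : dotp u w1 = 0.
  by apply: (orthogonal_submx _ w1M); rewrite addsmxSr.
have w1n0 : w1 != 0 by apply: contraNneq w1e => ->; rewrite dotpC dotp0l.
have indep v : dotp v w1 != 0 -> forall t, u + t *: v != 0.
  move=> vw t; apply/eqP => uv; move: (congr1 (fun x => dotp x w1) uv).
  rewrite dotpDl w1u add0r dotpZl dotp0l => /eqP; rewrite mulf_eq0 (negbTE vw) orbF.
  by move=> /eqP t0; move: uv; rewrite t0 scale0r addr0; apply/eqP.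
have [i iM] := exists_notin_submx rs.
have [v0 v0M] := orthogonal_witness iM; rewrite rowK => v0i.
have [vw|vw] := eqVneq (dotp v0 w1) 0; last first.
  by exists v0; split=> //; [exists i|exact: indep].
have ww : dotp w1 w1 != 0 by rewrite dotp_eq0.
have [iw|iw] := eqVneq (dotp (a i - z) w1) 0; last first.
  by exists w1; split=> //; [exists i|exact: indep].
exists (v0 + w1); split.
- by move=> j; rewrite dotpDr v0M w1Mi addr0.
- by exists i; rewrite dotpDr iw addr0.
- by apply: indep; rewrite dotpDl vw add0r.
Qed.

(** Apply the ratio test to the distances of the atoms from the hyperplane: the
rotation stops when the first atom reaches the hyperplane, and up to then no
atom has changed side. *)
Lemma rotate z u : u != 0 -> light z u ->
  (\rank (touch_mx z u) < minn (\rank (spread_mx z)) d.-1)%N ->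
  exists u', [/\ u' != 0, light z u' &
    (\rank (touch_mx z u) < \rank (touch_mx z u'))%N].
Proof.
move=> u0 zu rk; have [v [vM [i vi] uv]] := rotation_axis u0 rk.
pose p j := dotp (a j - z) u.
have touchE j x : (dotp (a j) x == dotp z x) = (dotp (a j - z) x == 0).
  by rewrite dotpBl subr_eq0.
have q0 j : p j = 0 -> dotp (a j - z) v = 0.
  by move=> pj; have := vM j; rewrite rowK touchE -/(p j) pj eqxx.
have [e [e0 [j ej]]] : exists e, e != 0 /\
    exists j, Num.sg (p j) * (e * dotp (a j - z) v) < 0.
  (* The sense of rotation that brings the atom [i] closer. *)
  exists (- Num.sg (p i) * dotp (a i - z) v).
  have pi0 : p i != 0 by apply: contraNneq vi => /q0 ->.
  split; first by rewrite mulf_neq0// oppr_eq0 sgr_eq0.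
  exists i; rewrite mulNr mulNr mulrN oppr_lt0 !mulrA.
  rewrite -expr2 sqr_sg pi0 mul1r -expr2 lt_def sqr_ge0 andbT.
  by rewrite expf_neq0.
have [|||t t0 [tp [k]]] := @ratio_test R 'I_n (fun j => `|p j|)
  (fun j => Num.sg (p j) * (e * dotp (a j - z) v)).
- by move=> ?; exact: normr_ge0.
- by move=> l /eqP; rewrite normr_eq0 => /eqP ->; rewrite sgr0 mul0r.
- by exists j.
rewrite normr_eq0 => pk0.
have sgE l : `|p l| + t * (Num.sg (p l) * (e * dotp (a l - z) v)) =
    Num.sg (p l) * dotp (a l - z) (u + (t * e) *: v).
  by rewrite dotpDr dotpZr mulrDr normrEsg -/(p l); ring.
rewrite sgE => /eqP; rewrite mulf_eq0 sgr_eq0 (negbTE pk0)/= => /eqP pk.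
have stay l : p l = 0 -> dotp (a l - z) (u + (t * e) *: v) = 0.
  by move=> pl; rewrite dotpDr dotpZr q0// mulr0 addr0.
exists (u + (t * e) *: v); split=> //.
  apply: le_lt_trans zu; apply: (weight_le w_gt0) => l.
  rewrite -subr_gt0 -dotpBl -(subr_gt0 (dotp z u)) -dotpBl -/(p l).
  case: (ltrgtP (p l) 0) => [pl|//|/stay ->]; last by rewrite ltxx.
  by have := tp l; rewrite sgE ltr0_sg// mulN1r oppr_ge0;
    move=> /le_lt_trans/[apply]; rewrite ltxx.
have MM' : (touch_mx z u <= touch_mx z (u + (t * e) *: v))%MS.
  apply/row_subP => l; rewrite rowK touchE -/(p l); case: eqP => [pl|_]; last first.
    exact: sub0mx.
  by rewrite (eq_row_sub l)// rowK touchE stay// eqxx.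
suff : (touch_mx z u < touch_mx z (u + (t * e) *: v))%MS.
  by rewrite ltmxErank => /andP[].
rewrite /ltmx MM'/=; apply/negP => M'M.
have : dotp (a k - z) v = 0.
  apply: (orthogonal_submx _ vM); apply: submx_trans M'M.
  by rewrite (eq_row_sub k)// rowK touchE pk eqxx.
move=> qk; move: pk; rewrite dotpDr dotpZr qk mulr0 addr0 => /eqP.
exact/negP.
Qed.

Lemma rotate_until z u : u != 0 -> light z u ->
  exists u', [/\ u' != 0, light z u' &
    (minn (\rank (spread_mx z)) d.-1 <= \rank (touch_mx z u'))%N].
Proof.
have [k] := ubnP (d - \rank (touch_mx z u)); elim: k u => // k IH u uk u0 zu.
have [|lt] := leqP (minn (\rank (spread_mx z)) d.-1) (\rank (touch_mx z u)).
  by exists u.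
have [u' [u'0 zu' uu']] := rotate u0 zu lt.
by apply: (IH u') => //; have := rank_leq_col (touch_mx z u'); lia.
Qed.

(** As [z] is a combination of the touching atoms, the vectors [a i - z] are
spanned by the differences of the distinct touching atoms to one of them. *)
Lemma card_touching z u (l : 'I_n -> R) :
  (forall i, dotp (a i) u != dotp z u -> l i = 0) -> \sum_i l i = 1 ->
  \sum_i l i *: a i = z ->
  (\rank (touch_mx z u) <
    #|` [fset a i | i in 'I_n & dotp (a i) u == dotp z u]%fset|)%N.
Proof.
move=> lT l1 lz; set S := [fset a i | i in _ & _]%fset.
have aS i : dotp (a i) u == dotp z u -> a i \in S.
  by move=> iz; apply/imfsetP; exists i => //; rewrite !inE.
have [i0 i0z] : exists i, dotp (a i) u == dotp z u.
  apply: contrapT => /forallNP nz; move: l1; rewrite big1 => [/eqP|i _].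
    by rewrite eq_sym oner_eq0.
  by apply: lT; apply/negP/nz.
rewrite (cardfsD1 (a i0)) aS// add1n ltnS.
set S0 := (S `\ a i0)%fset.
pose N : 'M[R]_(#|` S0|, d) := \matrix_j (nth 0 (enum_fset S0) j - a i0).
apply: leq_trans (rank_leq_row N); apply: mxrankS; apply/row_subP => i.
have aN j : dotp (a j) u == dotp z u -> (a j - a i0 <= N)%MS.
  move=> jz; have [->|ji] := eqVneq (a j) (a i0); first by rewrite subrr sub0mx.
  have jS0 : a j \in enum_fset S0 by rewrite in_fsetD1 ji aS.
  have jlt : (index (a j) (enum_fset S0) < #|` S0|)%N by rewrite index_mem.
  by rewrite (eq_row_sub (Ordinal jlt))// rowK /= nth_index.
rewrite rowK; case: ifP => [iz|_]; last exact: sub0mx.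
have -> : a i - z = (a i - a i0) - (z - a i0) by rewrite opprB addrA subrK.
rewrite addmx_sub ?aN// eqmx_opp.
have -> : z - a i0 = \sum_j l j *: (a j - a i0).
  under eq_bigr do rewrite scalerBr.
  by rewrite big_split/= sumrN -scaler_suml l1 scale1r lz.
apply: summx_sub => j _; have [jz|/lT ->] := boolP (dotp (a j) u == dotp z u).
  by rewrite scalemx_sub// aN.
by rewrite scale0r sub0mx.
Qed.

Lemma affdim_region z : 0 < alpha -> D z ->
  affdim D <= (\rank (spread_mx z))%:Z.
Proof.
move=> alpha0 Dz; rewrite /affdim asboolT; last by exists z.
have affD : aff_hull D `<=` [set y | (y - z <= spread_mx z)%MS].
  apply: smallest_sub => [x y t /= xz yz|y Dy /=].
    have -> : t *: x + (1 - t) *: y - z = t *: (x - z) + (1 - t) *: (y - z).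
      by apply/rowP => i; rewrite !mxE; ring.
    by rewrite addmx_sub// scalemx_sub.
  apply/negPn/negP => /orthogonal_witness[v vM]; rewrite (span_region alpha0 Dy) ?eqxx//.
  by move=> i; rewrite -(vM i) rowK.
rewrite lez_nat; apply/bigmax_leqP => k /asboolP[M [/eqP Mk Md]].
rewrite -{1}Mk; apply: mxrankS; apply/row_subP => i.
have [x [y [/affD/= xz /affD/= yz ->]]] := Md i.
have -> : x - y = (x - z) - (y - z) by rewrite opprB addrA subrK.
by rewrite addmx_sub// eqmx_opp.
Qed.

End Rotation.

Lemma affdim_interior (R : realType) (d : nat) (F : set 'rV[R]_d) z :
  F° z -> d%:Z <= affdim F.
Proof.
move=> zF; have Fz := interior_subset zF.
rewrite /affdim asboolT; last by exists z.
rewrite lez_nat; apply: (@bigop.leq_bigmax_cond _ _ (fun k : 'I_d.+1 => k : nat) ord_max).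
apply/asboolP; exists 1%:M; split=> [|i]; first by rewrite row_free_unit unitmx1.
set v := row i 1%:M; have [e e0 /(_ e)] := nbhs_line v zF.
rewrite gtr0_norm// => /(_ (lexx _)) Fe.
exists (z + v), z; split; last by rewrite addrC addKr.
  have -> : z + v = e^-1 *: (z + e *: v) + (1 - e^-1) *: z.
    by apply/rowP => j; rewrite !mxE; field; rewrite gt_eqF.
  by apply: affine_aff_hull; exact: sub_gen_smallest.
exact: sub_gen_smallest.
Qed.

(** * The region is a polytope *)

Section Polytope.
Context {R : realType} {d n : nat}.
Local Notation E := 'rV[R]_d.
Variables (a : 'I_n -> E) (w : 'I_n -> R) (alpha : R).
Hypothesis w_gt0 : forall i, 0 < w i.
Implicit Types (x y z u v : E) (t : R) (T : {set 'I_n}).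
Local Notation D := (region a w alpha).

(** The atoms outside [T] weigh less than [alpha], so that every closed
halfspace that contains all atoms of [T] contains the region. *)
Definition heavy T : Prop := weight w (fun i => i \notin T) < alpha.

(** If [x] is not in the hull of the atoms in [T], a separating hyperplane
through [x] leaves on its far side only atoms outside [T]. *)
Lemma region_heavy_hull x T : (0 < d)%N -> D x -> heavy T ->
  exists l : 'I_n -> R, [/\ forall i, 0 <= l i, forall i, i \notin T -> l i = 0,
    \sum_i l i = 1 & \sum_i l i *: a i = x].
Proof.
move=> d0 Dx hT.
have [[l [l0 lT l1 lx]]|[v xv]] := gordan (fun i => x - a i) (fun i => i \in T).
  exists l; split=> //; apply/esym/subr0_eq; rewrite -[RHS]lx.
  under [RHS]eq_bigr do rewrite scalerBr.
  by rewrite big_split/= sumrN -scaler_suml l1 scale1r.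
exfalso.
have [v' v'0 xv'] : exists2 v' : E, v' != 0 &
    forall i, i \in T -> 0 < dotp (x - a i) v'.
  have [v0|v0] := eqVneq v 0; last by exists v.
  have [u u0] := @exists_neq0 R _ d0; exists u => // i /xv.
  by rewrite v0 dotpC dotp0l ltxx.
have := Dx v' v'0; rewrite leNgt => /negP; apply; apply: le_lt_trans hT.
apply: (weight_le w_gt0) => i; apply: contraL => /xv'.
by rewrite dotpBl subr_gt0 -ltNge.
Qed.

(** A closed halfspace at [x] of weight below [alpha] makes the atoms outside it
a heavy set, and [x] cannot be a convex combination of these. *)
Lemma heavy_hull_region x :
  (forall T, heavy T -> exists l : 'I_n -> R, [/\ forall i, 0 <= l i,
     forall i, i \notin T -> l i = 0, \sum_i l i = 1 & \sum_i l i *: a i = x]) ->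
  D x.
Proof.
move=> hx u u0; rewrite leNgt; apply/negP => xu.
have [|l [l0 lT l1 lx]] := hx [set i | dotp (a i) u < dotp x u]%SET.
  apply: le_lt_trans xu; apply: (weight_le w_gt0) => i.
  by rewrite inE -leNgt.
have : \sum_i l i * (dotp x u - dotp (a i) u) = 0.
  under eq_bigr do rewrite mulrBr.
  rewrite sumrB -mulr_suml l1 mul1r -{1}lx dotp_suml.
  by under eq_bigr do rewrite dotpZl; rewrite subrr.
have ge0 i : 0 <= l i * (dotp x u - dotp (a i) u).
  have [ix|ix] := boolP (i \in [set i | dotp (a i) u < dotp x u]%SET).
    by rewrite mulr_ge0// subr_ge0 ltW//; rewrite inE in ix.
  by rewrite lT// mul0r.
move=> /(psumr_eq0P (fun i _ => ge0 i)) z.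
move: l1; rewrite big1 => [/eqP|i _]; first by rewrite eq_sym oner_eq0.
have [ix|/lT//] := boolP (i \in [set i | dotp (a i) u < dotp x u]%SET).
have /eqP := z i isT; rewrite mulf_eq0 => /orP[/eqP//|].
by move: ix; rewrite inE -subr_gt0 => /gt_eqF ->.
Qed.

(** The coordinates of the polyhedron are indexed by a set [T] and an atom [i]:
[l (T, i)] is the coefficient of [a i] in a convex combination of atoms of the
heavy set [T], and all these combinations represent the same point. *)
Lemma polytope_region : (0 < d)%N -> 0 < alpha -> polytope D.
Proof.
move=> d0 alpha0.
have hsetT : heavy [set: 'I_n]%SET.
  by rewrite /heavy /weight big_pred0// => i; rewrite inE.
pose I := ({set 'I_n} * 'I_n)%type.
pose L := [set l : I -> R | [/\
  forall T i, ~ (heavy T /\ i \in T) -> l (T, i) = 0,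
  forall T, heavy T -> \sum_i l (T, i) = 1 &
  forall T, heavy T ->
    \sum_i l (T, i) *: a i = \sum_i l ([set: 'I_n]%SET, i) *: a i]].
pose p (Ti : I) : E := if Ti.1 == [set: 'I_n]%SET then a Ti.2 else 0.
have combE (l : I -> R) : \sum_j l j *: p j = \sum_i l ([set: 'I_n]%SET, i) *: a i.
  rewrite (eq_bigr (fun j => l (j.1, j.2) *: p (j.1, j.2))); last by case.
  rewrite -(pair_bigA _ (fun T i => l (T, i) *: p (T, i)))/=.
  rewrite (bigD1 [set: 'I_n]%SET)//= [X in _ + X]big1 => [|T /negbTE TT].
    by rewrite addr0; apply: eq_bigr => i _; rewrite /p eqxx.
  by rewrite big1// => i _; rewrite /p /= TT scaler0.
suff -> : D = [set \sum_j l j *: p j | l in [set l | L l /\ forall j, 0 <= l j]].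
  apply: polytope_image => [l l' t [l0 l1 la] [l'0 l'1 l'a]|l [l0 l1 _] lge [T i]].
    split=> [T i Ti|T hT|T hT].
    - by rewrite l0// l'0// !mulr0 addr0.
    - by rewrite big_split/= -!mulr_sumr l1// l'1// !mulr1 subrKC.
    - have comb S : \sum_i (t * l (S, i) + (1 - t) * l' (S, i)) *: a i =
          t *: (\sum_i l (S, i) *: a i) + (1 - t) *: (\sum_i l' (S, i) *: a i).
        rewrite !scaler_sumr -big_split; apply: eq_bigr => i _.
        by rewrite scalerDl !scalerA.
      by rewrite !comb la// l'a.
  have [hT|nhT] := pselect (heavy T); last by rewrite l0 => [|[]].
  by rewrite -(l1 T hT) (bigD1 i)//= lerDl sumr_ge0.
apply/seteqP; split=> [x Dx|_ [l [[l0 l1 la] lge] <-]]; last first.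
  apply: heavy_hull_region => T hT; exists (fun i => l (T, i)); split=> //.
  - by move=> i iT; rewrite l0// => -[_]; apply/negP.
  - exact: l1.
  - by rewrite combE la.
have /choice[f fP] : forall T, exists l : 'I_n -> R, heavy T ->
    [/\ forall i, 0 <= l i, forall i, i \notin T -> l i = 0,
    \sum_i l i = 1 & \sum_i l i *: a i = x].
  move=> T; have [hT|] := pselect (heavy T); last by exists (fun=> 0).
  by have [l lP] := region_heavy_hull d0 Dx hT; exists l.
pose l (j : I) := if `[< heavy j.1 >] then f j.1 j.2 else 0.
have lE T : heavy T -> forall i, l (T, i) = f T i by move=> hT i; rewrite /l asboolT.
exists l; last first.
  have [_ _ _ <-] := fP _ hsetT; rewrite combE.
  by apply: eq_bigr => i _; rewrite lE.
split=> [|[T i]]; last first.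
  by rewrite /l; case: asboolP => // /fP[].
split=> [T i nTi|T hT|T hT].
- rewrite /l /=; case: asboolP => // hT; have [_ -> //] := fP _ hT.
  by apply/negP => iT; apply: nTi.
- by have [_ _ <- _] := fP _ hT; apply: eq_bigr => i _; rewrite lE.
- transitivity x.
    by have [_ _ _ <-] := fP _ hT; apply: eq_bigr => i _; rewrite lE.
  by have [_ _ _ <-] := fP _ hsetT; apply: eq_bigr => i _; rewrite lE.
Qed.

End Polytope.

(** * Finitely atomic measures *)

Section AtomicMeasure.
Context {R : realType} {d n : nat}.
Local Notation E := 'rV[R]_d.
Variables (mu : {measure set (borel_rV R d) -> \bar R}).
Variables (a : 'I_n -> E) (w : 'I_n -> R) (alpha : R).
Hypothesis w_gt0 : forall i, 0 < w i.
Hypothesis muE : forall A : set (borel_rV R d), measurable A ->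
  mu A = (\sum_(i < n) (w i)%:E * \d_(a i : borel_rV R d) A)%E.

Lemma measurable_open (A : set E) : open A ->
  measurable (A : set (borel_rV R d)).
Proof. by move=> oA; exact: sub_sigma_algebra. Qed.

Lemma measurable_closed (A : set E) : closed A ->
  measurable (A : set (borel_rV R d)).
Proof.
move=> cA; rewrite -[A]setCK; apply: measurableC; apply: measurable_open.
exact: closed_openC.
Qed.

Lemma mu_weight (A : set E) (T : pred 'I_n) :
  measurable (A : set (borel_rV R d)) ->
  (forall i, T i <-> A (a i)) -> mu A = (weight w T)%:E.
Proof.
move=> mA TA; rewrite muE// /weight [in RHS]big_mkcond -sumEFin; apply: eq_bigr => i _.
rewrite diracE; case: ifPn => Ti.
  by rewrite mem_set ?mule1//; apply/TA.
by rewrite memNset ?mule0// => /TA; apply/negP.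
Qed.

Lemma mu_halfspace (x u : E) :
  mu (halfspace x u) = (weight w (fun i => dotp x u <= dotp (a i) u))%:E.
Proof.
by apply: mu_weight => //; apply: measurable_closed; exact: closed_halfspace.
Qed.

Lemma mu_interior_halfspace (x u : E) : u != 0 ->
  mu (halfspace x u)° = (weight w (fun i => dotp x u < dotp (a i) u))%:E.
Proof.
move=> u0; apply: mu_weight => [|i]; last by rewrite interior_halfspace.
by apply: measurable_open; apply: open_interior.
Qed.

Lemma central_regionE : central_region mu alpha = region a w alpha.
Proof.
apply/seteqP; split=> x /=; rewrite /central_region /= /depth.
  move=> ax u u0; have [c c0 su] := normalize u0.
  rewrite -(weight_scale _ _ _ _ c0) -lee_fin -mu_halfspace.
  apply: (le_trans ax); apply: ereal_inf_lbound.
  by exists (halfspace x (c *: u)) => //; exists (c *: u).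
move=> Dx; apply/le_ereal_inf_tmp => _ [_ [u su <-] <-].
by rewrite mu_halfspace lee_fin; apply: Dx; exact: sphere_neq0.
Qed.

Lemma atoms_atomic i : atoms mu (a i).
Proof.
rewrite /atoms /= (@mu_weight _ (fun j => a j == a i)).
- by rewrite lte_fin /weight (bigD1 i)//= ltr_pwDl// sumr_ge0// => j _; exact: ltW.
- apply: measurable_closed.
  exact: (accessible_closed_set1 (hausdorff_accessible (@norm_hausdorff _ _))).
- by move=> j; split => [/eqP|->].
Qed.

End AtomicMeasure.

(** * Faces of the central region *)

Section Faces.
Context {R : realType} {d n : nat}.
Local Notation E := 'rV[R]_d.
Variables (mu : {measure set (borel_rV R d) -> \bar R}).
Variables (a : 'I_n -> E) (w : 'I_n -> R) (alpha : R).
Hypothesis w_gt0 : forall i, 0 < w i.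
Hypothesis muE : forall A : set (borel_rV R d), measurable A ->
  mu A = (\sum_(i < n) (w i)%:E * \d_(a i : borel_rV R d) A)%E.
Implicit Types (x y z u v : E) (F : set E) (t : R).
Local Notation D := (region a w alpha).
Local Notation light := (light a w alpha).

Lemma closure_region : closure D = D.
Proof. by rewrite -(closure_id _).1//; exact: closed_region. Qed.

Lemma touching_light z u : sphere u -> D z -> light z u ->
  touching D (halfspace z u).
Proof.
move=> su Dz zu; have u0 := sphere_neq0 su.
split; first by exists z, u.
move=> _; split.
  by exists z; split; [exact: lexx|rewrite closure_region].
apply/seteqP; split=> // y []; rewrite interior_halfspace//= => zy Dy.
by have := light_region w_gt0 u0 zu Dy; rewrite leNgt zy.
Qed.

(** By [light_region] the functional [u] is maximal over [F] at [z]. *)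
Lemma light_face z u F : u != 0 -> light z u -> F `<=` D -> relint F z ->
  F `<=` [set y | dotp y u = dotp z u].
Proof.
move=> u0 zu FD zF y Fy; apply: relint_argmax zF _ _ Fy => x Fx.
by apply: light_region zu _ => //; exact: FD.
Qed.

Lemma touching_face_exists x F : ~ D° x -> visible_faces x D F ->
  exists H, [/\ touching_face D F H, H x & (mu H° < alpha%:E)%E].
Proof.
move=> nx [[cF]]; rewrite closure_region => FD _ [Fout Fbd].
have witness z u : sphere u -> D z -> light z u -> dotp z u <= dotp x u ->
    F `<=` [set y | dotp y u = dotp z u] ->
    exists H, [/\ touching_face D F H, H x & (mu H° < alpha%:E)%E].
  move=> su Dz zu zx Fz; exists (halfspace z u); split=> //.
    by split; [exact: touching_light|rewrite bd_halfspace// sphere_neq0].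
  by rewrite (mu_interior_halfspace muE) ?sphere_neq0// lte_fin.
have [Dx|nDx] := pselect (D x).
  have [u su xu] := light_of_boundary w_gt0 nx.
  apply: (witness x u) => //; apply: light_face => //; first exact: sphere_neq0.
  by apply: Fbd; rewrite /bd closure_region.
have {}Fout : relint (conv_hull (F `|` [set x])) `&` D = set0 by exact: Fout.
(* The empty face is visible too, and has no relative interior point; there
   the exit point of a segment from the region to [x] takes the place of [z]. *)
have [[f0 Ff0]|F0] := pselect (F !=set0).
  have [z zF] := relint_nonempty cF (ex_intro _ f0 Ff0).
  have Dz : D z by apply: FD; exact: relint_sub.
  set G := conv_hull _ in Fout.
  have cG : @convex_set R E G by exact: convex_conv_hull.
  have FG : F `|` [set x] `<=` G by exact: sub_gen_smallest.
  have [y yG] := relint_nonempty cG (ex_intro _ x (FG x (or_intror erefl))).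
  have Gz : G z by apply: FG; left; exact: relint_sub.
  have [u [su yu zu]] : exists u, [/\ sphere u, 0 <= dotp (y - z) u & light z u].
    apply: light_of_direction => // t t0 t1 Dt.
    have : (relint G `&` D) (z + t *: (y - z)).
      by split=> //; exact: relint_segment.
    by rewrite Fout.
  have u0 := sphere_neq0 su.
  have Fz := light_face u0 zu FD zF.
  apply: (witness z u) => //; rewrite leNgt; apply/negP => xz.
  have Gle : G `<=` [set p | dotp p u <= dotp z u].
    apply: smallest_sub.
      apply/convex_setP => p q t t0 t1 /= pz qz.
      by rewrite dotpDl !dotpZl; nra.
    by move=> p [/Fz/= ->//|->]; exact: ltW.
  have yz : dotp y u = dotp z u.
    apply/le_anti; rewrite (Gle y (relint_sub yG))/=.
    by move: yu; rewrite dotpBl subr_ge0.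
  have := relint_argmax yG (u := u); rewrite yz => /(_ Gle x).
  by move=> /(_ (FG x (or_intror erefl))) xzE; move: xz; rewrite xzE ltxx.
have {}F0 : F = set0 by apply/eqP; apply: contrapT => /negP/set0P.
rewrite F0 in witness *.
have [[p Dp]|D0] := pselect (D !=set0).
  have [s [s0 Ds sx]] := last_point w_gt0 Dp nDx.
  set z := p + _ in Ds sx.
  have [u [su xu zu]] := light_of_direction w_gt0 Ds sx.
  by apply: (witness z u) => //; rewrite -subr_ge0 -dotpBl.
have [u su xu] := notin_region_sphere nDx.
exists (halfspace x u); split.
- split; last by [].
  by split; [exists x, u|move=> /D0].
- exact: lexx.
- rewrite (mu_interior_halfspace muE) ?sphere_neq0// lte_fin.
  exact: (light_of_closed w_gt0).
Qed.

Lemma face_atoms_of_light z u F : 0 < alpha -> u != 0 -> light z u -> D z ->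
  F `<=` D -> (F !=set0 -> relint F z) ->
  exists (S : {fset E}) (P : set E),
  [/\ hyperplane P, [set` S] `<=` atoms mu `&` P,
    Num.min (affdim D + 1) d%:Z <= (#|` S|)%:Z & F `<=` conv_hull [set` S]].
Proof.
move=> alpha0 u0 zu Dz FD zF.
have [u' [u'0 zu' rk]] := rotate_until w_gt0 u0 zu.
pose S := [fset a i | i in 'I_n & dotp (a i) u' == dotp z u']%fset.
exists S, [set y | dotp y u' = dotp z u']; split.
- by exists u', (dotp z u').
- move=> y /imfsetP[i /= + yE]; rewrite inE/= => iz; rewrite yE.
  split; last exact/eqP.
  exact: (atoms_atomic w_gt0 muE).
- have [l [l0 lT l1 lz]] := hull_of_light w_gt0 u'0 zu' Dz erefl.
  have Sc := card_touching lT l1 lz; rewrite -/S in Sc.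
  by have := affdim_region alpha0 Dz; rewrite ge_min; lia.
move=> y Fy.
have yz := light_face u'0 zu' FD (zF (ex_intro _ y Fy)) Fy.
have [l [l0 lT l1 <-]] := hull_of_light w_gt0 u'0 zu' (FD y Fy) yz.
apply: convex_sum => //; first exact: convex_conv_hull.
move=> i li; apply: sub_gen_smallest => /=; apply/imfsetP; exists i => //.
rewrite !inE/=; apply/negPn/negP => iz.
by move: li; rewrite lT// ltxx.
Qed.

(** The reflection in [z] maps points of the region near [z] to points of the
region, and [z] is the midpoint of each such pair. *)
Lemma face_interior F z : is_face D F -> F z -> D° z -> F° z.
Proof.
move=> [_ FD Fmid] Fz zD.
have refl : \forall y \near z, D (2 *: z - y).
  have : 2 *: z - y @[y --> nbhs z] --> 2 *: z - z.
    exact: (@cvgB _ _ _ (nbhs z) _ _ _ _ _ (cvg_cst _) cvg_id).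
  by apply; rewrite scaler_nat mulr2n addrK.
rewrite /interior; near=> y.
have [//] : F y /\ F (2 *: z - y).
apply: Fmid.
- by near: y; exact: zD.
- by near: y; exact: refl.
- by rewrite addrC subrK scalerA mulVf ?scale1r// pnatr_eq0.
Unshelve. all: by end_near. Qed.

Lemma face_atoms F : (0 < d)%N -> faces D F -> affdim F < d%:Z ->
  F !=set0 \/ 0 < alpha ->
  exists (S : {fset E}) (P : set E),
  [/\ hyperplane P, [set` S] `<=` atoms mu `&` P,
    Num.min (affdim D + 1) d%:Z <= (#|` S|)%:Z & F `<=` conv_hull [set` S]].
Proof.
move=> d0; rewrite /faces /= closure_region => faceF Fd Falpha.
have [cF FD _] := faceF.
have [[f Ff]|F0] := pselect (F !=set0).
  have [z zF] := relint_nonempty cF (ex_intro _ f Ff).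
  have Fz := relint_sub zF.
  have zD : ~ D° z.
    move=> /(face_interior faceF Fz)/affdim_interior dF.
    by move: Fd; rewrite ltNge dF.
  have [u su zu] := light_of_boundary w_gt0 zD.
  apply: (@face_atoms_of_light z u) => //; last exact: FD.
    (* For [alpha <= 0] no open halfspace is light. *)
    rewrite ltNge; apply/negP => alpha0.
    have : 0 < (0 : R); last by rewrite ltxx.
    apply: lt_le_trans alpha0; apply: le_lt_trans zu.
    by apply: sumr_ge0 => i _; exact: ltW.
  exact: sphere_neq0.
have alpha0 : 0 < alpha by case: Falpha => // /F0.
have {F0} -> : F = set0 by apply/eqP; apply: contrapT => /negP/set0P.
have [[p Dp]|D0] := pselect (D !=set0).
  have [x nDx] := exists_notin_region a w d0 alpha0.
  have [s [s0 Ds sx]] := last_point w_gt0 Dp nDx.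
  have [u [su _ zu]] := light_of_direction w_gt0 Ds sx.
  by apply: (face_atoms_of_light alpha0 (sphere_neq0 su) zu) => //; case.
have [u u0] := @exists_neq0 R _ d0; exists fset0, [set y | dotp y u = 0].
split=> //; first by exists u, 0.
by rewrite /affdim asboolF// ge_min addNr lexx.
Qed.

End Faces.

Theorem corollary13 (R : realType) (d : nat) (hd : (0 < d)%N)
    (mu : {measure set (borel_rV R d) -> \bar R}) (hmu : finitely_atomic mu)
    (alpha : R) :
  (forall (x : 'rV[R]_d) (F : set 'rV[R]_d),
     ~ (central_region mu alpha)° x ->
     visible_faces x (central_region mu alpha) F ->
     exists H : set 'rV[R]_d,
       [/\ touching_face (central_region mu alpha) F H,
           H x &
           (mu (H°) < alpha%:E)%E])
  /\ (0 < alpha -> polytope (central_region mu alpha))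
  /\ (forall F : set 'rV[R]_d,
        faces (central_region mu alpha) F ->
        affdim F < d%:Z ->
        F !=set0 \/ 0 < alpha ->
        exists (S : {fset 'rV[R]_d}) (P : set 'rV[R]_d),
          [/\ hyperplane P,
              [set` S] `<=` atoms mu `&` P,
              Num.min (affdim (central_region mu alpha) + 1) d%:Z
                <= (#|` S|)%:Z &
              F `<=` conv_hull [set` S]]).
Proof.
have [n [a [w [w_gt0 muE]]]] := hmu.
rewrite (central_regionE alpha muE); split; [|split].
- by move=> x F; exact: touching_face_exists.
- exact: polytope_region.
- by move=> F; exact: face_atoms.
Qed.
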